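(* Let $G$ be a locally compact (not necessarily Hausdorff) groupoid with Hausdorff unit space $G^0$ and open range and source maps $r,s\colon G\to G^0$. If $G$ is étale, then the locally compact Hausdorff groupoid $\mathfrak{H}G$ is étale.
   Context: Topological spaces are not assumed Hausdorff. A subset is quasi-compact if every open cover of it has a finite subcover, and compact if it is quasi-compact and Hausdorff. A space $X$ is locally compact if every point has a compact neighbourhood. For a net $(x_\nu)_\nu$ in $X$, $\lim_\nu x_\nu$ denotes the set of all its limit points; the net is primitive if every cluster point is a limit point. For a locally compact space $X$, the Fell compactification $\mathfrak{K}X$ is the set of all limit sets of primitive nets in $X$, with the topology generated by the subbasis of all sets $\mathcal{U}_V=\{A\in\mathfrak{K}X\mid A\cap V\neq\emptyset\}$ ($V\subseteq X$ open) and $\mathcal{U}^Q=\{A\in\mathfrak{K}X\mid A\cap Q=\emptyset\}$ ($Q\subseteq X$ quasi-compact). Put $\mathfrak{H}X=\mathfrak{K}X\setminus\{\emptyset\}$ with the subspace topology. The set $X$ is regarded as a subset of $\mathfrak{H}X$ via $x\mapsto\{x\}$. A locally compact groupoid is a topological groupoid (multiplication and inversion continuous) whose underlying space is locally compact, i.e. every point has a compact (quasi-compact and Hausdorff) neighbourhood. For subsets $A,B\subseteq G$, $A^{-1}=\{x^{-1}\mid x\in A\}$ and $AB=\{xy\mid x\in A,\ y\in B,\ s(x)=r(y)\}$. Under the stated assumptions on $G$, the space $\mathfrak{H}G$ is a locally compact Hausdorff groupoid with unit space $(\mathfrak{H}G)^0$ equal to the closure of $G^0$ in $\mathfrak{H}G$,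 range map $\mathfrak{r}(A)=AA^{-1}$, source map $\mathfrak{s}(A)=A^{-1}A$, multiplication $(A,B)\mapsto AB$ for $\mathfrak{s}(A)=\mathfrak{r}(B)$, and inversion $A\mapsto A^{-1}$. An open subset $V$ of a topological groupoid is a $G$-set if its image under the range map is open in the unit space and the range map restricts to a homeomorphism from $V$ onto this image. A groupoid is étale if it is covered by its open $G$-sets. *)

(* Defs.v *)
From HB Require Import structures.
From mathcomp Require Import all_boot all_classical.
From mathcomp Require Export topology.

Set Implicit Arguments.
Unset Strict Implicit.
Unset Printing Implicit Defensive.

Local Open Scope classical_set_scope.

(** [compact] of the library is quasi-compactness: it does not include the
    Hausdorff property.  The library's [locally_compact] asks for closed
    quasi-compact neighbourhoods, hence is not used for non-Hausdorff spaces. *)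

Definition locally_compact_space (X : topologicalType) : Prop :=
  forall x : X, exists K : set X,
    [/\ nbhs x K, compact K & hausdorff_space (set_type K)].

Definition relatively_open (X : topologicalType) (B A : set X) : Prop :=
  exists2 W, open W & A = B `&` W.

(** * Nets and the Fell compactification *)

Record net (X : Type) := Net {
  net_index : Type;
  net_le : net_index -> net_index -> Prop;
  net_val :> net_index -> X;
  net_inhabited : exists i : net_index, True;
  net_le_refl : forall i, net_le i i;
  net_le_trans : forall i j k, net_le i j -> net_le j k -> net_le i k;
  net_directed : forall i j, exists k, net_le i k /\ net_le j k }.

Definition net_lim (X : topologicalType) (N : net X) : set X :=
  [set x | forall U, nbhs x U -> exists i, forall j, net_le i j -> U (N j)].

Definition net_cluster (X : topologicalType) (N : net X) : set X :=
  [set x | forall U, nbhs x U -> forall i, exists j, net_le i j /\ U (N j)].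

Definition primitive_net (X : topologicalType) (N : net X) : Prop :=
  net_cluster N `<=` net_lim N.

Definition primitive_limit_sets (X : topologicalType) : set (set X) :=
  [set A | exists2 N : net X, primitive_net N & A = net_lim N].

Definition fellK (X : topologicalType) : Type :=
  set_type (@primitive_limit_sets X).

HB.instance Definition _ (X : topologicalType) := Choice.on (fellK X).

Definition fell_hit (X : topologicalType) (V : set X) : set (fellK X) :=
  [set A | val A `&` V !=set0].

Definition fell_miss (X : topologicalType) (Q : set X) : set (fellK X) :=
  [set A | val A `&` Q = set0].

Definition fell_subbase (X : topologicalType) : set (set (fellK X)) :=
  [set U | (exists2 V, open V & U = fell_hit V) \/
           (exists2 Q, compact Q & U = fell_miss Q)].

HB.instance Definition _ (X : topologicalType) :=
  isSubBaseTopological.Build (fellK X) (@fell_subbase X) id.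

(** The topology on [set_type _] is the subspace topology. *)
Definition fellH (X : topologicalType) : Type :=
  set_type [set A : fellK X | val A !=set0].

HB.instance Definition _ (X : topologicalType) :=
  Topological.copy (fellH X) (set_type [set A : fellK X | val A !=set0]).

Definition fell_pts (X : topologicalType) (A : fellH X) : set X := val (val A).

(** * Groupoids *)

(** Units are identified with the corresponding elements of [G]; the value of
    [gmul x y] is irrelevant unless [gsrc x = grng y]. *)
Record groupoid (G : Type) := Groupoid {
  grng : G -> G;
  gsrc : G -> G;
  gmul : G -> G -> G;
  ginv : G -> G;
  grng_rng : forall x, grng (grng x) = grng x;
  gsrc_rng : forall x, gsrc (grng x) = grng x;
  grng_src : forall x, grng (gsrc x) = gsrc x;
  gsrc_src : forall x, gsrc (gsrc x) = gsrc x;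
  grng_mul : forall x y, gsrc x = grng y -> grng (gmul x y) = grng x;
  gsrc_mul : forall x y, gsrc x = grng y -> gsrc (gmul x y) = gsrc y;
  gmulA : forall x y z, gsrc x = grng y -> gsrc y = grng z ->
    gmul x (gmul y z) = gmul (gmul x y) z;
  gmul_rng : forall x, gmul (grng x) x = x;
  gmul_src : forall x, gmul x (gsrc x) = x;
  grng_inv : forall x, grng (ginv x) = gsrc x;
  gsrc_inv : forall x, gsrc (ginv x) = grng x;
  gmul_inv : forall x, gmul x (ginv x) = grng x;
  ginv_mul : forall x, gmul (ginv x) x = gsrc x }.

Definition unit_space (G : Type) (g : groupoid G) : set G := range (grng g).

Definition gset_inv (G : Type) (g : groupoid G) (A : set G) : set G :=
  ginv g @` A.

Definition gset_mul (G : Type) (g : groupoid G) (A B : set G) : set G :=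
  [set z | exists x y, [/\ A x, B y, gsrc g x = grng g y & z = gmul g x y]].

Section TopologicalGroupoids.
Variables (G : topologicalType) (g : groupoid G).

Definition topological_groupoid : Prop :=
  {within [set p : G * G | gsrc g p.1 = grng g p.2],
     continuous (fun p : G * G => gmul g p.1 p.2)} /\
  continuous (ginv g).

Definition locally_compact_groupoid : Prop :=
  topological_groupoid /\ locally_compact_space G.

Definition open_range_source : Prop :=
  forall U : set G, open U ->
    relatively_open (unit_space g) (grng g @` U) /\
    relatively_open (unit_space g) (gsrc g @` U).

(** The range map restricts to a homeomorphism [V -> grng g @` V], with
    inverse [t]. *)
Definition open_Gset (V : set G) : Prop :=
  [/\ open V,
      relatively_open (unit_space g) (grng g @` V),
      {within V, continuous (grng g)} &
      exists t : G -> G,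
        {in V, cancel (grng g) t} /\ {within grng g @` V, continuous t}].

Definition etale : Prop := forall x : G, exists2 V, open_Gset V & V x.

(** [h] is the groupoid structure of [fellH G]: it is determined by these
    equations, up to the irrelevant values of [gmul h]. *)
Record is_fell_groupoid (h : groupoid (fellH G)) : Prop := IsFellGroupoid {
  fell_units : unit_space h =
    closure [set A | exists2 u, unit_space g u & fell_pts A = [set u]];
  fell_rng : forall A,
    fell_pts (grng h A) = gset_mul g (fell_pts A) (gset_inv g (fell_pts A));
  fell_src : forall A,
    fell_pts (gsrc h A) = gset_mul g (gset_inv g (fell_pts A)) (fell_pts A);
  fell_mul : forall A B, gsrc h A = grng h B ->
    fell_pts (gmul h A B) = gset_mul g (fell_pts A) (fell_pts B);
  fell_inv : forall A, fell_pts (ginv h A) = gset_inv g (fell_pts A) }.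

End TopologicalGroupoids.

(* Main.v *)
Require Import Defs.
From mathcomp Require Import all_boot all_classical topology finmap.

(** The proof works with ultrafilters instead of nets.  A primitive net and any
    ultrafilter refining its tails have the same limits, so the Fell
    compactification consists of the limit sets of ultrafilters
    ([primitive_limit_setsE]).  A filter on [fellH X] converges to [A] as soon
    as it eventually hits every open set that [A] hits and, for each point
    outside [A], eventually avoids some neighbourhood of that point: compactness
    of the sets to be missed does the rest ([fell_cvg]).  For locally compact [X]
    a point outside a limit set has a quasi-compact neighbourhood missed by
    it ([fell_avoid]), so that [fellH X] is Hausdorff; it is locally compact because
    ultrafilters may be averaged along an ultrafilter ([compact_hit]).

    Let [G] be an etale groupoid with Hausdorff unit space and let [A] be the
    limit set of an ultrafilter [F].  All points of [A] have the same range and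
    the same source, because the limits of [F] under these maps are unique, and
    [A] is closed under [x y^-1 z], because [z z^-1 z = z] along [F]
    ([fell_coset_like]).  So [A] behaves like a coset of an isotropy group, and
    the whole set-theoretic algebra reduces to right translations by single
    elements: [A B = A y] for every [y] in [B] as soon as the source of [A] is
    the range of [B], and [A A^-1 = A x^-1] for every [x] in [A].  Two facts on
    translations carry the proof.

    - [translate_exists]: [A y] is again a limit set.  Near [y] the range map
      has a continuous section [t], and [A y] is the limit set of the image of
      [F] under [z |-> z t(s z)].

    - [fell_cvg_translate]: if [a_i] tends to [A], and if for each
      neighbourhood of [y] eventually [c_i = a_i y'] with [y'] in this
      neighbourhood, then [c_i] tends to [A y].

    The first one makes [fellH G] closed under products, hence a groupoid.  The
    second one gives the continuity of the multiplication and of the range map,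
    and also of the inverse of the range map on [hit V] for an open [G]-set [V]:
    a limit set [B] that meets [V] in [y] is the translate of its range by [y],
    and [y] depends continuously on the range of [B] because [V] is a [G]-set.
    The range map sends [hit V] onto the units of [fellH G] lying over the
    relatively open set [r(V)], so the sets [hit V] are open [G]-sets; they cover
    [fellH G]. *)

Set Implicit Arguments.
Unset Strict Implicit.
Unset Printing Implicit Defensive.

Local Open Scope classical_set_scope.

(** * Limit sets of ultrafilters *)

Definition limits (X : topologicalType) (F : set_system X) : set X :=
  [set x | F --> x].

(** If [F] is an ultrafilter finer than the tails of a net [N], then
    [lim N <= lim F <= cluster N], and the two ends agree for a primitive net.
    Conversely an ultrafilter [F] is the tail filter of the net of its pointed
    members, for which clustering and converging agree by maximality of [F]. *)
Lemma primitive_limit_setsE (X : topologicalType) (A : set X) :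
  primitive_limit_sets A <-> exists2 F, UltraFilter F & A = limits F.
Proof.
split=> [[N primN ->]|[F FU ->]].
  pose tail i := [set x | exists2 j, net_le i j & N j = x].
  have tailP : ProperFilter (filter_from setT tail).
    apply: filter_from_proper; last first.
      by move=> i _; exists (N i); exists i => //; exact: net_le_refl.
    apply: filter_from_filter.
      by have [i _] := net_inhabited N; exists i.
    move=> i j _ _; have [k [ik jk]] := net_directed i j.
    exists k => // _ [l kl <-]; split; exists l => //; exact: net_le_trans kl.
  have [F [FU subF]] := ultraFilterLemma tailP.
  exists F => //; apply/seteqP; split=> x.
    move=> limx U /limx[i iU]; apply: subF; exists i => // _ [j ij <-].
    exact: iU.
  move=> Fx; apply: primN => U xU i.
  have Fi : F (tail i) by apply: subF; exists i.
  by have [_ [[j ij <-] Uj]] := filter_ex (filterI Fi (Fx _ xU)); exists j.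
pose I := {p : set X * X | F p.1 /\ p.1 p.2}.
have FI S : F S -> exists p : I, (sval p).1 = S.
  move=> FS; have [x Sx] := filter_ex FS.
  by exists (exist _ (S, x) (conj FS Sx)).
pose le (p q : I) := (sval q).1 `<=` (sval p).1.
have le_trans p q r : le p q -> le q r -> le p r.
  by move=> pq qr; exact: subset_trans pq.
have directed p q : exists r, le p r /\ le q r.
  have [r re] := FI _ (filterI (svalP p).1 (svalP q).1).
  by exists r; split; rewrite /le re => x [].
have inhab : exists p : I, True.
  by have [p _] := FI _ (@filterT _ F _); exists p.
pose N := @Net X I le (fun p => (sval p).2) inhab (fun p => @subset_refl _ _)
  le_trans directed.
have limN x : F --> x -> net_lim N x.
  move=> Fx U /Fx FU'; have [p pe] := FI U FU'; exists p => q.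
  by move=> pq; rewrite -pe; apply: pq; exact: (svalP q).2.
exists N.
  move=> x clx; apply: limN => U xU.
  have [//|FnU] := in_ultra_setVsetC U FU.
  have [p pe] := FI _ FnU; have [q [pq Uq]] := clx U xU p.
  by exfalso; move: (pq _ (svalP q).2); rewrite pe; apply.
apply/seteqP; split=> x; first exact: limN.
move=> limx U /limx[p pU]; apply: (filterS _ (svalP p).1) => y py.
have py' : F (sval p).1 /\ (sval p).1 y by split=> //; exact: (svalP p).1.
exact: (pU (exist _ (_, y) py') (@subset_refl _ _)).
Qed.

Lemma ultraP T (F : set_system T) : ProperFilter F ->
  (forall A, F A \/ F (~` A)) -> UltraFilter F.
Proof.
move=> PF FP; split=> // G PG FG; apply/seteqP; split=> [A GA|]; last exact: FG.
have [//|/FG GnA] := FP A.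
by have [x []] := filter_ex (filterI GA GnA).
Qed.

Lemma ultra_fmap T U (f : T -> U) (F : set_system T) :
  UltraFilter F -> UltraFilter (f @ F).
Proof.
by move=> FU; apply: ultraP => A; exact: (in_ultra_setVsetC (f @^-1` A) FU).
Qed.

Lemma nbhs_open_sub (X : topologicalType) (x : X) U : nbhs x U ->
  exists O, [/\ open O, O x & O `<=` U].
Proof. by rewrite nbhsE => -[O [oO Ox] OU]; exists O. Qed.

Lemma hausdorff_set_type (T : topologicalType) (A : set T) :
  hausdorff_space T -> hausdorff_space (set_type A).
Proof.
move=> hT x y xy; apply: val_inj; apply: hT => U V.
by move=> /(@initial_continuous _ _ (val : set_type A -> T)) xU
  /(@initial_continuous _ _ (val : set_type A -> T)) yV;
  have [z [Uz Vz]] := xy _ _ xU yV; exists (val z).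
Qed.

Lemma cvg_within_app T (U : topologicalType) (f : T -> U) (D : set T)
    (F : set_system T) (l : U) : Filter F ->
  f @ F --> l -> f @ within D F --> l.
Proof.
by move=> FF fl W lW; have := fl _ lW; apply: (@filterS _ F) => p Wp _.
Qed.

(** * The topology of nonempty limit sets *)

Section FellTopology.
Variable X : topologicalType.

Definition hit (V : set X) : set (fellH X) :=
  [set A | fell_pts A `&` V !=set0].

Definition miss (Q : set X) : set (fellH X) :=
  [set A | fell_pts A `&` Q = set0].

Lemma fell_subbase_open (U : set (fellK X)) : @fell_subbase X U ->
  open (val @^-1` U : set (fellH X)).
Proof.
move=> sU; exists U => //; exists [set U]; last by rewrite bigcup_set1.
by move=> _ ->; apply: finI_from1.
Qed.

Lemma open_hit V : open V -> open (hit V).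
Proof.
by move=> oV; apply: (@fell_subbase_open (fell_hit V)); left; exists V.
Qed.

Lemma open_miss Q : compact Q -> open (miss Q).
Proof.
by move=> cQ; apply: (@fell_subbase_open (fell_miss Q)); right; exists Q.
Qed.

Lemma nbhs_hit (A : fellH X) V x : nbhs x V -> fell_pts A x -> nbhs A (hit V).
Proof.
move=> /nbhs_open_sub[O [oO Ox OV]] Ax.
apply: (@filterS _ (nbhs A) _ (hit O)) => [B [y [By Oy]]|].
  by exists y; split=> //; exact: OV.
by apply: open_nbhs_nbhs; split; [exact: open_hit|exists x].
Qed.

Lemma nbhs_miss (A : fellH X) Q : compact Q -> miss Q A -> nbhs A (miss Q).
Proof.
by move=> cQ AQ; apply: open_nbhs_nbhs; split=> //; exact: open_miss.
Qed.

(** Missing a quasi-compact set may be tested one point at a time: the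
    neighbourhoods avoided near its points form an open cover. *)
Lemma fell_cvg (Phi : set_system (fellH X)) (A : fellH X) : Filter Phi ->
    (forall V, open V -> hit V A -> Phi (hit V)) ->
    (forall x, ~ fell_pts A x -> exists2 U, nbhs x U & Phi (miss U)) ->
  Phi --> A.
Proof.
move=> FPhi hitA missA W [_ [[O [/= D DI <-] <-]]] [b Db bA] OW.
apply: filterS OW _; apply: (@filterS _ _ _ (val @^-1` b)) => [B bB|].
  by exists b.
have [E ED bE] := DI b Db; rewrite -bE in bA *.
suff PhiE (U : set (fellK X)) : [set` E] U -> Phi (val @^-1` U : set (fellH X)).
  by have := filter_bigI FPhi PhiE; apply: filterS => B BE U EU; exact: BE.
move=> EU.
have /set_mem sU := ED _ EU; have UA := bA _ EU.
case: sU UA => [[V oV ->]|[Q cQ ->]]; first exact: hitA.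
rewrite /fell_miss /= => AQ.
have /compact_near_coveringP nc := cQ.
apply: filterS (nc _ Phi (fun B x => ~ fell_pts B x) FPhi _) => [B QB|x Qx].
  by apply/seteqP; split=> // x [Bx /QB].
have [|N xN PhiN] := missA x.
  by move=> Ax; have : set0 x by rewrite -AQ.
exists (N, miss N) => //= -[y B] /= [Ny BN] By.
by have : set0 y by rewrite -BN.
Qed.

Lemma fell_ptsP (A : fellH X) :
  exists2 F, UltraFilter F & fell_pts A = limits F.
Proof. by apply/primitive_limit_setsE; exact/set_mem/(valP (val A)). Qed.

Lemma fell_pts_neq0 (A : fellH X) : exists x, fell_pts A x.
Proof. by have /set_mem[x Ax] := valP A; exists x. Qed.

Lemma fell_pts_inj : injective (@fell_pts X).
Proof. by move=> A B /val_inj/val_inj. Qed.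

Lemma ultra_fellH (F : set_system X) : UltraFilter F -> limits F !=set0 ->
  exists A : fellH X, fell_pts A = limits F.
Proof.
move=> FU F0.
have PF : primitive_limit_sets (limits F).
  by apply/primitive_limit_setsE; exists F.
pose K : fellK X := SigSub (mem_set PF).
have K0 : [set A : fellK X | val A !=set0] K by [].
by exists (SigSub (mem_set K0)).
Qed.

(** Every nonempty limit set is a limit of points: [p] converges to the limit
    set of [F] along [F] itself. *)
Lemma fell_point_cvg (p : X -> fellH X) (F : set_system X) (A : fellH X) :
    (forall x, fell_pts (p x) = [set x]) -> UltraFilter F ->
  fell_pts A = limits F -> p @ F --> A.
Proof.
move=> pE FU AF; apply: fell_cvg => [V oV [x]|x].
  rewrite AF => -[Fx Vx]; have := Fx _ (open_nbhs_nbhs (conj oV Vx)).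
  by apply: (@filterS _ F) => z Vz; exists z; rewrite pE.
rewrite AF => /existsNP[U /not_implyP[xU nFU]]; exists U => //.
have [//|] := in_ultra_setVsetC U FU.
apply: (@filterS _ F) => z nUz; apply/seteqP; split=> // y [].
by rewrite pE => ->.
Qed.

Hypothesis lcX : locally_compact_space X.

(** Compact Hausdorff neighbourhoods are regular spaces, so their points have
    arbitrarily small closed, hence quasi-compact, neighbourhoods. *)
Lemma compact_nbhs_sub (x : X) U : nbhs x U ->
  exists Q, [/\ nbhs x Q, compact Q & Q `<=` U].
Proof.
move=> xU; have [K [xK cK hK]] := lcX x.
have Kx : K x := nbhs_singleton xK.
have cT : compact [set: set_type K].
  move=> F PF _.
  have PvF : ProperFilter ((val : set_type K -> X) @ F).
    exact: fmap_proper_filter.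
  have [|p [Kp clp]] := cK _ PvF.
    by apply: (@filterE _ F _ (val @^-1` K)) => y; exact: set_valP.
  exists (SigSub (mem_set Kp)); split=> // A B FA [_ [[O oO <-] Op] OB].
  have vA : (val @ F) (val @` A).
    by apply: (@filterS _ F _ A) => // y Ay; exists y.
  have [_ [[y Ay <-] Oy]] := clp _ O vA (open_nbhs_nbhs (conj oO Op)).
  by exists y; split=> //; apply: OB.
pose x' : set_type K := SigSub (mem_set Kx).
have reg : filter_from (nbhs x') closure --> x'.
  exact: compact_regular hK cT filterT.
have [C [_ [[O oO <-] Ox] OC] CU] :=
  reg _ (@initial_continuous _ _ (val : set_type K -> X) x' _ xU).
exists (val @` closure C); split.
- apply: filterS (filterI xK (open_nbhs_nbhs (conj oO Ox))) => y [Ky Oy].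
  by exists (SigSub (mem_set Ky)) => //; apply/subset_closure/OC.
- apply: continuous_compact.
    apply: continuous_subspaceT; exact: initial_continuous.
  by apply: subclosed_compact cT _ => //; exact: closed_closure.
- by move=> _ [y Cy <-]; exact: CU.
Qed.

Lemma locally_compact_nbhs_neq (x y : X) : x <> y ->
  exists2 U, nbhs x U & ~ U y.
Proof.
move=> xy; have [K [xK cK]] := lcX x; rewrite open_hausdorff => hK.
have Kx : K x := nbhs_singleton xK.
have [Ky|nKy] := pselect (K y); last by exists K.
pose x' : set_type K := SigSub (mem_set Kx).
pose y' : set_type K := SigSub (mem_set Ky).
have [|[A B] /=] := hK x' y'; first by apply/eqP => /(congr1 val).
move=> [/set_mem Ax /set_mem By] [[O oO OA] _ /eqP AB].
exists O; first by apply: open_nbhs_nbhs; split=> //; move: Ax; rewrite -OA.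
by move=> Oy; have : set0 y' by rewrite -AB -OA.
Qed.

Lemma limits_principal (x : X) : limits (principal_filter x) = [set x].
Proof.
apply/seteqP; split=> y; last first.
  by move=> -> U /nbhs_singleton Ux; exact/principal_filterP.
move=> Fy; apply: contrapT => yx; have [U yU] := locally_compact_nbhs_neq yx.
by apply; exact: (Fy _ yU).
Qed.

Lemma fell_point (x : X) : exists A : fellH X, fell_pts A = [set x].
Proof.
rewrite -limits_principal; apply: ultra_fellH.
  exact: principal_filter_ultra.
by rewrite limits_principal; exists x.
Qed.

(** If [x] is not a limit of the ultrafilter defining [A], some open
    neighbourhood of [x] is not in this ultrafilter and so contains none of its
    limits. *)
Lemma fell_avoid (A : fellH X) x : ~ fell_pts A x ->
  exists Q, [/\ nbhs x Q, compact Q & fell_pts A `&` Q = set0].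
Proof.
have [F FU ->] := fell_ptsP A => /existsNP[U /not_implyP[xU FU']].
have [O [oO Ox OU]] := nbhs_open_sub xU.
have [Q [xQ cQ QO]] := compact_nbhs_sub (open_nbhs_nbhs (conj oO Ox)).
exists Q; split=> //; apply/seteqP; split=> // y [Fy /QO Oy].
by apply: FU'; apply: filterS OU _; apply: Fy; exact: open_nbhs_nbhs.
Qed.

Lemma fellH_hausdorff : hausdorff_space (fellH X).
Proof.
suff sub (A B : fellH X) : cluster (nbhs A) B -> fell_pts A `<=` fell_pts B.
  move=> A B AB; apply: fell_pts_inj; apply/seteqP; split; apply: sub => //.
  by move=> U V AU BV; rewrite setIC; exact: AB.
move=> AB x Ax; apply: contrapT => /fell_avoid[Q [xQ cQ BQ]].
have [C [[y [Cy Qy]] CQ]] := AB _ _ (nbhs_hit xQ Ax) (nbhs_miss cQ BQ).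
by have : set0 y by rewrite -CQ.
Qed.

(** An ultrafilter [Phi] on limit sets containing [hit K] converges to the limit
    set of the average [L] along [Phi] of ultrafilters [F A] defining the [A].
    Points of [A] chosen in [K] have a limit in [K] along [Phi], and it is a
    limit of [L]; so the limit set of [L] is nonempty and meets [K]. *)
Lemma compact_hit K : compact K -> compact (hit K).
Proof.
rewrite !compact_ultra => cK Phi PhiU PhiK.
have [F FP] := choice (fun A => (exists2P _ _).1 (fell_ptsP A)).
have FPA A : ProperFilter (F A) by case: (FP A) => -[].
have exK A : exists x, fell_pts A x /\ (hit K A -> K x).
  have [[x [Ax Kx]]|nAK] := pselect (hit K A); first by exists x.
  by have [x Ax] := fell_pts_neq0 A; exists x.
have [p pP] := choice exK.
pose L : set_system X := [set S | Phi [set A | F A S]].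
have LF : Filter L.
  split=> [|S T LS LT|S T ST].
  - by apply: (@filterE _ Phi _ [set A | F A setT]) => A; exact: filterT.
  - apply: (@filterS _ Phi) (@filterI _ Phi _ _ _ LS LT) => A [FS FT].
    exact: filterI.
  - by apply: (@filterS _ Phi _ [set A | F A S]) => A; exact: filterS.
have LP : ProperFilter L.
  apply: Build_ProperFilter_ex => S LS.
  by have [A FS] := @filter_ex _ Phi _ _ LS; exact: filter_ex FS.
have LU : UltraFilter L.
  apply: ultraP => S.
  have [LS|LS] := in_ultra_setVsetC [set A | F A S] PhiU; [by left|right].
  apply: filterS LS => A /= nFS; have [FU _] := FP A.
  by have [|] := in_ultra_setVsetC S FU.
have [x [Kx pPhi]] :=
  cK _ (ultra_fmap p PhiU) (filterS (fun A => (pP A).2) PhiK).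
have Lx : limits L x.
  move=> U /nbhs_open_sub[O [oO Ox OU]].
  have : L O; last exact: filterS.
  have PhiO : Phi [set A | O (p A)] := pPhi _ (open_nbhs_nbhs (conj oO Ox)).
  apply: filterS PhiO => A OpA; have [Ap _] := pP A.
  by move: Ap; rewrite (FP A).2 => Ap; apply: Ap; exact: open_nbhs_nbhs.
have [A AL] := ultra_fellH LU (ex_intro _ x Lx).
exists A; split; first by exists x; rewrite AL.
apply: fell_cvg => [V oV [y]|y].
  rewrite AL => -[Ly Vy].
  have [Q [yQ cQ QV]] := compact_nbhs_sub (open_nbhs_nbhs (conj oV Vy)).
  have PhiQ : Phi [set B | F B Q] := Ly _ yQ.
  apply: filterS PhiQ => B; have [FU BE] := FP B.
  rewrite /= => FQ; rewrite compact_ultra in cQ.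
  have [z [Qz Fz]] := cQ _ FU FQ.
  by exists z; split; [rewrite BE|exact: QV].
rewrite AL => /existsNP[U /not_implyP[/nbhs_open_sub[O [oO Oy OU]] LnU]].
exists O; first exact: open_nbhs_nbhs.
have [LO|LnO] := in_ultra_setVsetC O LU.
  by exfalso; apply: LnU; exact: filterS LO.
have PhinO : Phi [set B | F B (~` O)] := LnO.
apply: filterS PhinO => B FB; apply/seteqP; split=> // z [Bz Oz].
have := Bz; rewrite (FP B).2 => Fz.
have FO : F B O := Fz _ (open_nbhs_nbhs (conj oO Oz)).
by have [w []] := filter_ex (filterI FB FO).
Qed.

Lemma fellH_locally_compact : locally_compact_space (fellH X).
Proof.
move=> A; have [x Ax] := fell_pts_neq0 A.
have [K [xK cK _]] := lcX x.
exists (hit K); split; last exact/hausdorff_set_type/fellH_hausdorff.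
  exact: nbhs_hit Ax.
exact: compact_hit.
Qed.

End FellTopology.

(** * Algebra of subsets of a groupoid *)

Section GroupoidAlgebra.
Variables (G : Type) (g : groupoid G).
Local Notation r := (grng g).
Local Notation s := (gsrc g).
Local Notation "x *' y" := (gmul g x y) (at level 40, left associativity).
Local Notation "x ^-1" := (ginv g x).
Local Notation "A ** B" := (gset_mul g A B) (at level 40, left associativity).
Local Notation "A ^!" := (gset_inv g A) (at level 2, format "A ^!").

Lemma gmulVK x y : s x = r y -> (x *' y) *' y^-1 = x.
Proof.
by move=> xy; rewrite -gmulA ?grng_inv// gmul_inv -xy gmul_src.
Qed.

Lemma gdivK x y : s x = s y -> (x *' y^-1) *' y = x.
Proof.
by move=> xy; rewrite -gmulA ?grng_inv ?gsrc_inv// ginv_mul -xy gmul_src.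
Qed.

Lemma ginvK x : x^-1^-1 = x.
Proof.
rewrite -[LHS](gmul_src g) gsrc_inv grng_inv -ginv_mul gmulA ?gsrc_inv//.
by rewrite ginv_mul gsrc_inv gmul_rng.
Qed.

Lemma ginvM x y : s x = r y -> (x *' y)^-1 = y^-1 *' x^-1.
Proof.
move=> xy; have yx : s y^-1 = r x^-1 by rewrite gsrc_inv grng_inv.
have e : (x *' y) *' (y^-1 *' x^-1) = r x.
  by rewrite gmulA ?gmulVK ?gmul_inv// gsrc_mul// grng_inv.
rewrite -[LHS](gmul_src g) gsrc_inv grng_mul// -e gmulA ?ginv_mul.
- by rewrite gsrc_mul// -[s y](grng_inv g) -(grng_mul yx) gmul_rng.
- by rewrite gsrc_inv.
- by rewrite gsrc_mul// grng_mul// grng_inv.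
Qed.

Lemma gset_mulA A B C : A ** (B ** C) = (A ** B) ** C.
Proof.
apply/seteqP; split=> z.
  case=> [x [_ [Ax [y [w [By Cw yw ->]]]]]]; rewrite grng_mul// => xy ->.
  exists (x *' y), w; rewrite gsrc_mul//; split=> //; last by rewrite gmulA.
  by exists x, y.
case=> [_ [w [[x [y [Ax By xy ->]]]]]]; rewrite gsrc_mul// => Cw yw ->.
exists x, (y *' w); rewrite grng_mul//; split=> //; last by rewrite gmulA.
by exists y, w.
Qed.

Lemma gset_invK A : A^!^! = A.
Proof.
apply/seteqP; split=> [_ [_ [x Ax <-] <-]|x Ax]; first by rewrite ginvK.
by exists x^-1; [exists x|rewrite ginvK].
Qed.

Lemma gset_invM A B : (A ** B)^! = B^! ** A^!.
Proof.
apply/seteqP; split=> [_ [_ [x [y [Ax By xy ->]]] <-]|].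
  exists y^-1, x^-1; rewrite ginvM// gsrc_inv grng_inv; split=> //.
    by exists y.
  by exists x.
move=> z [_ [_ [[y By <-] [x Ax <-]]]].
rewrite gsrc_inv grng_inv => yx ->.
by exists (x *' y); [exists x, y|rewrite ginvM].
Qed.

Definition translate A y := A ** [set y].

Lemma translateP A y z :
  translate A y z <-> exists x, [/\ A x, s x = r y & z = x *' y].
Proof.
split=> [[x [_ [Ax -> xy ->]]]|[x [Ax xy ->]]]; first by exists x.
by exists x, y.
Qed.

(** A nonempty coset-like set is a coset [x H] of a subgroup [H] of an isotropy
    group; this form treats left and right cosets alike. *)
Definition coset_like A :=
  (forall x y, A x -> A y -> r x = r y /\ s x = s y) /\
  (forall x y z, A x -> A y -> A z -> A ((x *' y^-1) *' z)).

Lemma coset_like_mulVK A : coset_like A -> (A ** A^!) ** A = A.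
Proof.
move=> [Ars A3]; apply/seteqP; split=> z; last first.
  move=> Az; exists (z *' z^-1), z; rewrite gsrc_mul ?grng_inv// gsrc_inv.
  split=> //; last by rewrite gdivK.
  by exists z, z^-1; rewrite grng_inv; split=> //; exists z.
by case=> [_ [y [[x [_ [Ax [w Aw <-] _ ->]]]]]] Ay _ ->; exact: A3.
Qed.

(** Write [b] in [B] as [(b y^-1) y]; the factor [b y^-1] lies in
    [B B^-1 = A^-1 A], and it is absorbed by [A] since [A A^-1 A = A]. *)
Lemma gset_mul_translate A B y : coset_like A -> coset_like B ->
  A^! ** A = B ** B^! -> B y -> A ** B = translate A y.
Proof.
move=> [Ars A3] [Brs _] AB By; apply/seteqP; split=> z; last first.
  by move=> /translateP[x [Ax xy ->]]; exists x, y.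
move=> [x [b [Ax Bb xb ->]]]; apply/translateP.
have [_ bys] := Brs _ _ Bb By.
have : (B ** B^!) (b *' y^-1).
  by exists b, y^-1; rewrite grng_inv; split=> //; exists y.
rewrite -AB => -[_ [a [[a0 Aa0 <-] Aa]]]; rewrite gsrc_inv => a0a bye.
have [_ xa0] := Ars _ _ Ax Aa0.
have e : x *' (b *' y^-1) = (x *' a0^-1) *' a.
  by rewrite bye gmulA// ?gsrc_inv// grng_inv.
exists (x *' (b *' y^-1)); split.
- by rewrite e; exact: A3.
- by rewrite !gsrc_mul ?grng_mul ?grng_inv ?gsrc_inv.
- rewrite -gmulA ?gdivK// ?grng_mul ?grng_inv//.
  by rewrite gsrc_mul ?grng_inv// gsrc_inv.
Qed.

Lemma coset_like_inv A : coset_like A -> coset_like A^!.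
Proof.
move=> [Ars A3]; split=> [_ _ [x Ax <-] [y Ay <-]|].
  by rewrite !grng_inv !gsrc_inv; have [] := Ars _ _ Ax Ay.
move=> _ _ _ [x Ax <-] [y Ay <-] [z Az <-]; rewrite ginvK.
have [rxy sxy] := Ars _ _ Ax Ay; have [ryz syz] := Ars _ _ Ay Az.
exists ((z *' y^-1) *' x); first exact: A3.
rewrite !ginvM ?ginvK ?gmulA ?grng_inv ?gsrc_inv//.
by rewrite gsrc_mul ?gsrc_inv ?grng_inv.
Qed.

Lemma gset_mulV_translate A x : coset_like A -> A x ->
  A ** A^! = translate A x^-1.
Proof.
move=> cA Ax; apply: gset_mul_translate => //; first exact: coset_like_inv.
  by rewrite gset_invK.
by exists x.
Qed.

Lemma translateKV A y : (forall x, A x -> s x = r y) ->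
  translate (translate A y) y^-1 = A.
Proof.
move=> Ay; apply/seteqP; split=> z.
  case/translateP=> [_ [/translateP[x [Ax xy ->]] _ ->]].
  by rewrite gmulVK.
move=> Az; apply/translateP; exists (z *' y); have zy := Ay _ Az.
rewrite gsrc_mul// grng_inv gmulVK//; split=> //.
by apply/translateP; exists z.
Qed.

End GroupoidAlgebra.

(** * Limit sets in an etale groupoid *)

Section EtaleGroupoid.
Variables (G : topologicalType) (g : groupoid G).
Hypothesis lcG : locally_compact_groupoid g.
Hypothesis hausdorffG0 : hausdorff_space (set_type (unit_space g)).
Hypothesis etaleG : etale g.

Local Notation r := (grng g).
Local Notation s := (gsrc g).
Local Notation "x *' y" := (gmul g x y) (at level 40, left associativity).
Local Notation "x ^-1" := (ginv g x).
Local Notation "A ** B" := (gset_mul g A B) (at level 40, left associativity).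
Local Notation "A ^!" := (gset_inv g A) (at level 2, format "A ^!").
Local Notation pts := (@fell_pts G).

Lemma gmul_cvg I (F : set_system I) (a b : I -> G) x y : Filter F ->
  a @ F --> x -> b @ F --> y -> s x = r y ->
  (\forall i \near F, s (a i) = r (b i)) ->
  (fun i => a i *' b i) @ F --> x *' y.
Proof.
move=> FF ax by_ xy ab U xyU.
have /subspace_continuousP/(_ (x, y) xy U xyU) near_xy := lcG.1.1.
have pF : (fun i => (a i, b i)) @ F --> (x, y) by exact: cvg_pair.
have near_i : F [set i | s (a i) = r (b i) -> U (a i *' b i)] := pF _ near_xy.
by apply: filterS (filterI near_i ab) => i [Ui abi]; exact: Ui.
Qed.

Lemma ginv_cvg I (F : set_system I) (a : I -> G) x : Filter F ->
  a @ F --> x -> (fun i => (a i)^-1) @ F --> x^-1.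
Proof. by move=> FF ax; apply: (cvg_comp _ _ ax); exact: lcG.1.2. Qed.

Lemma grng_cvg I (F : set_system I) (a : I -> G) x : Filter F ->
  a @ F --> x -> (fun i => r (a i)) @ F --> r x.
Proof.
move=> FF ax; rewrite -gmul_inv; under eq_fun do rewrite -gmul_inv.
apply: gmul_cvg => //; first exact: ginv_cvg.
  by rewrite grng_inv.
by apply: nearW => i; rewrite grng_inv.
Qed.

Lemma gsrc_cvg I (F : set_system I) (a : I -> G) x : Filter F ->
  a @ F --> x -> (fun i => s (a i)) @ F --> s x.
Proof.
move=> FF ax; rewrite -(grng_inv g); under eq_fun do rewrite -(grng_inv g).
exact: (grng_cvg _ (ginv_cvg _ ax)).
Qed.

Lemma grng_continuous : continuous r.
Proof. by move=> x; apply: (@grng_cvg _ _ id). Qed.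

Lemma gsrc_continuous : continuous s.
Proof. by move=> x; apply: (@gsrc_cvg _ _ id). Qed.

Lemma unit_rng x : unit_space g (r x). Proof. by exists x. Qed.

Lemma unit_src x : unit_space g (s x).
Proof. by exists (s x) => //; exact: grng_src. Qed.

Lemma unit_separate u v : unit_space g u -> unit_space g v -> u <> v ->
  exists O P, [/\ nbhs u O, nbhs v P &
    forall w, unit_space g w -> O w -> P w -> False].
Proof.
move=> uu vv uv; move: hausdorffG0; rewrite open_hausdorff.
move=> /(_ (SigSub (mem_set uu)) (SigSub (mem_set vv)))[|[A B]] /=.
  by apply/eqP => /(congr1 val).
move=> [/set_mem Au /set_mem Bv] [[O oO OA] [P oP PB] /eqP AB].
exists O, P; split.
- by apply: open_nbhs_nbhs; split=> //; move: Au; rewrite -OA.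
- by apply: open_nbhs_nbhs; split=> //; move: Bv; rewrite -PB.
move=> w ww Ow Pw; pose w' : set_type (unit_space g) := SigSub (mem_set ww).
by have : set0 w' by rewrite -AB -OA -PB.
Qed.

Lemma unit_cvg_unique I (F : set_system I) (a : I -> G) u v :
    ProperFilter F -> (forall i, unit_space g (a i)) ->
    unit_space g u -> unit_space g v ->
  a @ F --> u -> a @ F --> v -> u = v.
Proof.
move=> FF ua uu vv au av; apply: contrapT => uv.
have [O [P [uO vP OP]]] := unit_separate uu vv uv.
have FOP : F (a @^-1` O `&` a @^-1` P).
  by apply: filterI; [exact: (au _ uO)|exact: (av _ vP)].
by have [i [Oi Pi]] := filter_ex FOP; exact: (OP (a i)).
Qed.

(** Along an ultrafilter [F] with limits [x], [y], [z], the ranges converge in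
    the Hausdorff unit space, and [w = w w^-1 w] converges to [x y^-1 z]. *)
Lemma fell_coset_like (A : fellH G) : coset_like g (pts A).
Proof.
have [F FU ->] := fell_ptsP A.
have rs x y : F --> x -> F --> y -> r x = r y /\ s x = s y.
  move=> Fx Fy; split.
    apply: (@unit_cvg_unique _ F r) => *; do ?exact: unit_rng.
      exact: (grng_cvg _ Fx).
    exact: (grng_cvg _ Fy).
  apply: (@unit_cvg_unique _ F s) => *; do ?exact: unit_src.
    exact: (gsrc_cvg _ Fx).
  exact: (gsrc_cvg _ Fy).
split=> [x y|x y z Fx Fy Fz]; first exact: rs.
have [_ sxy] := rs _ _ Fx Fy; have [ryz _] := rs _ _ Fy Fz.
have : (fun w => (w *' w^-1) *' w) @ F --> (x *' y^-1) *' z.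
  apply: gmul_cvg => //.
  - apply: gmul_cvg => //; first exact: (ginv_cvg _ Fy).
      by rewrite grng_inv.
    by apply: nearW => w; rewrite grng_inv.
  - by rewrite gsrc_mul ?gsrc_inv ?grng_inv.
  - by apply: nearW => w; rewrite gmul_inv gsrc_rng.
by under eq_fun do rewrite gmul_inv gmul_rng.
Qed.

Lemma fell_inv_exists (A : fellH G) :
  exists B : fellH G, pts B = gset_inv g (pts A).
Proof.
have [x Ax] := fell_pts_neq0 A.
have [F FU AF] := fell_ptsP A.
suff e : limits (ginv g @ F) = gset_inv g (pts A).
  rewrite -e; apply: ultra_fellH; first exact: ultra_fmap.
  by exists x^-1; rewrite e; exists x.
rewrite AF; apply/seteqP; split=> [y Fy|_ [y Fy <-]]; last first.
  exact: (ginv_cvg _ (Fy : id @ F --> y)).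
exists y^-1; last by rewrite ginvK.
have := ginv_cvg _ Fy; rewrite /= => {}Fy.
suff : (fun z => z^-1^-1) @ F --> y^-1 by under eq_fun do rewrite ginvK.
exact: Fy.
Qed.

(** Let [t] be the section of the range map through [y] given by an open
    [G]-set.  If the ultrafilter [F] has limit set [A], its image under
    [m z = z t(s z)] converges to all [x y] with [x] in [A]; as [z] is recovered
    from [m z] as [m z t(s z)^-1], a limit [w] of the image gives the limit
    [w y^-1] of [F]. *)
Lemma translate_exists (A : fellH G) y :
    (forall x, pts A x -> s x = r y) ->
  exists B : fellH G, pts B = translate g (pts A) y.
Proof.
move=> Ay; have [x0 Ax0] := fell_pts_neq0 A.
have [F FU AF] := fell_ptsP A.
have [V [oV [W oW rV] _ [t [tK tcont]]] Vy] := etaleG y.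
pose m z := z *' t (s z).
have rVy : (r @` V) (r y) by exists y.
have Wy : W (r y) by move: rVy; rewrite rV => -[].
have Fx0 : F --> x0 by move: Ax0; rewrite AF.
have sF : s @ F --> r y by rewrite -(Ay _ Ax0); exact: (gsrc_cvg _ Fx0).
have FD : \forall z \near F, (r @` V) (s z).
  have FW : F (s @^-1` W) := sF _ (open_nbhs_nbhs (conj oW Wy)).
  by apply: filterS FW => z Wz; rewrite rV; split=> //; exact: unit_src.
have rt : \forall z \near F, s z = r (t (s z)).
  by apply: filterS FD => z [v Vv vz]; rewrite -vz (tK _ (mem_set Vv)).
have tF : (fun z => t (s z)) @ F --> y.
  have ty : t @ within (r @` V) (nbhs (r y)) --> t (r y).
    by move/subspace_continuousP : tcont; exact.
  rewrite (tK _ (mem_set Vy)) in ty => U /ty /sF sU.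
  have {}sU : F [set z | (r @` V) (s z) -> U (t (s z))] := sU.
  by apply: filterS (filterI FD sU) => z [rz]; exact.
have smF : \forall z \near F, s (t (s z)) = s (m z).
  by apply: filterS rt => z zt; rewrite /m gsrc_mul.
suff e : limits (m @ F) = translate g (pts A) y.
  rewrite -e; apply: ultra_fellH; first exact: ultra_fmap.
  exists (x0 *' y); rewrite e; apply/translateP; exists x0; split=> //.
  exact: Ay.
apply/seteqP; split=> w; last first.
  move=> /translateP[x [Ax xy ->]].
  by apply: gmul_cvg => //; move: Ax; rewrite AF.
move=> mw.
have sw : s w = s y.
  apply: (@unit_cvg_unique _ F (s \o m)) => *; do ?exact: unit_src.
    exact: (gsrc_cvg _ mw).
  apply: cvg_trans (gsrc_cvg _ tF); apply: near_eq_cvg.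
  exact: smF.
have wy : F --> w *' y^-1.
  have : (fun z => m z *' (t (s z))^-1) @ F --> w *' y^-1.
    apply: gmul_cvg => //; first exact: ginv_cvg.
      by rewrite grng_inv.
    by apply: filterS smF => z <-; rewrite grng_inv.
  apply: cvg_trans; rewrite -[X in X `=>` _](_ : id @ F = F)//.
  apply: near_eq_cvg; apply: filterS rt => z zt.
  by rewrite /m gmulVK.
apply/translateP; exists (w *' y^-1); split.
- by rewrite AF.
- by rewrite gsrc_mul ?grng_inv// gsrc_inv.
- by rewrite gdivK.
Qed.

(** The elements [y'] are only required to exist near [y], not to be given by a
    function, so that they can be picked in varying limit sets.  A point [q]
    outside [A y] has another source than [y], which is an open condition, or
    [q y^-1] is outside [A] and then has a quasi-compact neighbourhood [Q]
    missed by [A]; for [q'] near [q], [y'] near [y] and [a_i] missing [Q], the product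
    [q' y'^-1] lies in [Q], hence [q'] is not in [a_i y']. *)
Lemma fell_cvg_translate I (F : set_system I) (a c : I -> fellH G)
    (A C : fellH G) y : Filter F -> a @ F --> A ->
    pts C = translate g (pts A) y ->
    (forall V, nbhs y V -> \forall i \near F, exists2 y', V y' &
      pts (c i) = translate g (pts (a i)) y') ->
  c @ F --> C.
Proof.
move=> FF aA Cy cF.
have ax i y' x : pts (c i) = translate g (pts (a i)) y' ->
    pts (a i) x -> s x = r y'.
  move=> cy ax; have [z] := fell_pts_neq0 (c i).
  rewrite cy => /translateP[x' [ax' <- _]].
  by have [] := (fell_coset_like (a i)).1 _ _ ax ax'.
apply: fell_cvg => [V oV [z]|q].
  rewrite Cy => -[/translateP[x [Ax xy ->]] Vxy].
  have /subspace_continuousP/(_ (x, y) xy V) := lcG.1.1.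
  move=> /(_ (open_nbhs_nbhs (conj oV Vxy)))[[U1 U2] /= [U1x U2y] U12].
  have FA1 : F [set i | hit U1 (a i)] := aA _ (nbhs_hit U1x Ax).
  apply: (@filterS _ F) (filterI FA1 (cF _ U2y)) => i.
  move=> [[x' [ax' U1x']] [y' U2y' cy]].
  have x'y' := ax _ _ _ cy ax'.
  exists (x' *' y'); split; first by rewrite cy; apply/translateP; exists x'.
  by apply: (U12 (x', y')).
move=> nCq; have [sqy|sqy] := pselect (s q = s y); last first.
  have [O [P [qO yP OP]]] := unit_separate (unit_src q) (unit_src y) sqy.
  exists (s @^-1` O); first exact: gsrc_continuous.
  have := cF _ (gsrc_continuous yP); apply: (@filterS _ F) => i [y' Py' cy].
  apply/seteqP; split=> // z []; rewrite cy => /translateP[x [_ xy' ->]].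
  by rewrite /= gsrc_mul// => Oz; apply: (OP (s y')) => //; exact: unit_src.
have nA : ~ pts A (q *' y^-1).
  move=> Aqy; apply: nCq; rewrite Cy; apply/translateP; exists (q *' y^-1).
  by rewrite gsrc_mul ?grng_inv// gsrc_inv gdivK.
have [Q [qyQ cQ AQ]] := fell_avoid lcG.2 nA.
have qy : (fun p : G * G => p.1 *' p.2^-1) @
    within [set p | s p.1 = s p.2] (nbhs (q, y)) --> q *' y^-1.
  apply: gmul_cvg.
  - by apply: cvg_within_app; exact: cvg_fst.
  - apply: ginv_cvg.
    by apply: cvg_within_app; exact: cvg_snd.
  - by rewrite grng_inv.
  - by rewrite near_withinE; apply: nearW => p /= ->; rewrite grng_inv.
have [[U V] /= [qU yV] UV] := qy _ qyQ.
exists U => //.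
have FA : F [set i | miss Q (a i)] := aA _ (nbhs_miss cQ AQ).
apply: (@filterS _ F) (filterI FA (cF _ yV)) => i [aQ [y' Vy' cy]].
apply/seteqP; split=> // z []; rewrite cy => /translateP[x [ax' xy' ->]] Uz.
have : set0 x; last by [].
rewrite -aQ; split=> //.
have := UV (x *' y', y') (conj Uz Vy'); rewrite /= gmulVK//; apply.
exact: gsrc_mul.
Qed.

(** * The groupoid of nonempty limit sets *)

Lemma fell_mul_exists (A B : fellH G) :
  (pts A)^! ** pts A = pts B ** (pts B)^! ->
  exists C : fellH G, pts C = pts A ** pts B.
Proof.
move=> AB; have [y By] := fell_pts_neq0 B.
have cA := fell_coset_like A; have cB := fell_coset_like B.
rewrite (gset_mul_translate cA cB AB By).
apply: translate_exists => // x Ax.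
have : ((pts A)^! ** pts A) (s x).
  by exists x^-1, x; rewrite gsrc_inv ginv_mul; split=> //; exists x.
rewrite AB => -[b [_ [Bb [b' Bb' <-] _ e]]].
have : s (s x) = r b'.
  by rewrite e gsrc_mul ?gsrc_inv// grng_inv; have [] := cB.1 _ _ Bb Bb'.
by rewrite gsrc_src => ->; have [] := cB.1 _ _ Bb' By.
Qed.

(** The axioms are identities between products of sets; they follow from
    associativity and from [A A^-1 A = A]. *)
Lemma fell_groupoid_exists : exists h : groupoid (fellH G),
  [/\ forall A, pts (grng h A) = pts A ** (pts A)^!,
      forall A, pts (gsrc h A) = (pts A)^! ** pts A,
      forall A B, gsrc h A = grng h B -> pts (gmul h A B) = pts A ** pts B &
      forall A, pts (ginv h A) = (pts A)^!].
Proof.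
have [inv invE] := choice fell_inv_exists.
have rng_ex A : exists B : fellH G, pts B = pts A ** (pts A)^!.
  by rewrite -invE; apply: fell_mul_exists; rewrite invE gset_invK.
have src_ex A : exists B : fellH G, pts B = (pts A)^! ** pts A.
  by rewrite -invE; apply: fell_mul_exists; rewrite invE gset_invK.
have [rng rngE] := choice rng_ex; have [src srcE] := choice src_ex.
have mul_ex (AB : fellH G * fellH G) : exists C : fellH G,
    src AB.1 = rng AB.2 -> pts C = pts AB.1 ** pts AB.2.
  have [e|ne] := pselect (src AB.1 = rng AB.2); last by exists AB.1 => /ne.
  by have [|C CE] := @fell_mul_exists AB.1 AB.2;
    [rewrite -srcE -rngE e|exists C].
have [mul' mul'E] := choice mul_ex; pose mul A B := mul' (A, B).
have mulE A B : src A = rng B -> pts (mul A B) = pts A ** pts B.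
  exact: (mul'E (A, B)).
have mulVK A : (pts A ** (pts A)^!) ** pts A = pts A.
  exact/coset_like_mulVK/fell_coset_like.
have mulKV A : ((pts A)^! ** pts A) ** (pts A)^! = (pts A)^!.
  by have := mulVK (inv A); rewrite invE gset_invK.
have AB A B : src A = rng B -> (pts A)^! ** pts A = pts B ** (pts B)^!.
  by move=> e; rewrite -srcE -rngE e.
have rngrng A : rng (rng A) = rng A.
  by apply: fell_pts_inj; rewrite !rngE gset_invM gset_invK gset_mulA mulVK.
have srcrng A : src (rng A) = rng A.
  apply: fell_pts_inj.
  by rewrite srcE !rngE gset_invM gset_invK gset_mulA mulVK.
have rngsrc A : rng (src A) = src A.
  apply: fell_pts_inj.
  by rewrite rngE !srcE gset_invM gset_invK gset_mulA mulKV.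
have srcsrc A : src (src A) = src A.
  by apply: fell_pts_inj; rewrite !srcE gset_invM gset_invK gset_mulA mulKV.
have rnginv A : rng (inv A) = src A.
  by apply: fell_pts_inj; rewrite rngE srcE invE gset_invK.
have srcinv A : src (inv A) = rng A.
  by apply: fell_pts_inj; rewrite rngE srcE invE gset_invK.
have rngmul A B : src A = rng B -> rng (mul A B) = rng A.
  move=> e; apply: fell_pts_inj; rewrite !rngE mulE// gset_invM gset_mulA.
  by rewrite -(gset_mulA _ (pts A)) -(AB _ _ e) gset_mulA mulVK.
have srcmul A B : src A = rng B -> src (mul A B) = src B.
  move=> e; apply: fell_pts_inj; rewrite !srcE mulE// gset_invM gset_mulA.
  by rewrite -(gset_mulA _ (pts B)^!) (AB _ _ e) gset_mulA mulKV.
have mulA A B C : src A = rng B -> src B = rng C ->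
    mul A (mul B C) = mul (mul A B) C.
  move=> e f; apply: fell_pts_inj.
  by rewrite !mulE ?srcmul ?rngmul// gset_mulA.
have mulrng A : mul (rng A) A = A.
  by apply: fell_pts_inj; rewrite mulE// rngE mulVK.
have mulsrc A : mul A (src A) = A.
  by apply: fell_pts_inj; rewrite mulE// srcE gset_mulA mulVK.
have mulinv A : mul A (inv A) = rng A.
  by apply: fell_pts_inj; rewrite mulE// rngE invE.
have invmul A : mul (inv A) A = src A.
  by apply: fell_pts_inj; rewrite mulE// srcE invE.
by exists (Groupoid rngrng srcrng rngsrc srcsrc rngmul srcmul mulA mulrng
  mulsrc rnginv srcinv mulinv invmul).
Qed.

Variable h : groupoid (fellH G).
Hypothesis hrngE : forall A, pts (grng h A) = pts A ** (pts A)^!.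
Hypothesis hsrcE : forall A, pts (gsrc h A) = (pts A)^! ** pts A.
Hypothesis hmulE : forall A B, gsrc h A = grng h B ->
  pts (gmul h A B) = pts A ** pts B.
Hypothesis hinvE : forall A, pts (ginv h A) = (pts A)^!.

Let coset (A : fellH G) := fell_coset_like A.

Lemma fellH_rng_translate A x : pts A x ->
  pts (grng h A) = translate g (pts A) x^-1.
Proof. by move=> Ax; rewrite hrngE; exact: gset_mulV_translate. Qed.

Lemma fellH_rng_mem A x : pts A x -> pts (grng h A) (r x).
Proof.
move=> Ax; rewrite hrngE; exists x, x^-1; rewrite grng_inv gmul_inv.
by split=> //; exists x.
Qed.

Lemma fellH_rng_mem_eq A x z : pts A x -> pts (grng h A) z -> r z = r x.
Proof.
move=> /fellH_rng_mem Hx Hz.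
by have [-> _] := (coset _).1 _ _ Hz Hx; rewrite grng_rng.
Qed.

Lemma fellH_mul_translate A B y : gsrc h A = grng h B -> pts B y ->
  pts (gmul h A B) = translate g (pts A) y.
Proof.
move=> e By; rewrite hmulE//; apply: gset_mul_translate => //.
by rewrite -hsrcE -hrngE e.
Qed.

Lemma fellH_rng_continuous : continuous (grng h).
Proof.
move=> A; have [x Ax] := fell_pts_neq0 A.
apply: (@fell_cvg_translate _ (nbhs A) id _ A _ x^-1) => //.
  exact: fellH_rng_translate.
move=> V xV; have := nbhs_hit (lcG.1.2 _ _ xV) Ax.
apply: filterS => B [x' [Bx' Vx']]; exists x'^-1 => //.
exact: fellH_rng_translate.
Qed.

Lemma fellH_mul_continuous :
  {within [set p : fellH G * fellH G | gsrc h p.1 = grng h p.2],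
    continuous (fun p => gmul h p.1 p.2)}.
Proof.
apply/subspace_continuousP => -[A B] /= AB; have [y By] := fell_pts_neq0 B.
apply: (@fell_cvg_translate _ _ fst _ A _ y) => //.
- by apply: cvg_within_app; exact: cvg_fst.
- exact: fellH_mul_translate.
move=> V yV; rewrite near_withinE.
have : nbhs (A, B) (snd @^-1` hit V).
  by apply: cvg_snd; exact: nbhs_hit By.
apply: (@filterS _ (nbhs (A, B))) => -[A' B'] /= [y' [By' Vy']] AB'.
exists y' => //.
exact: fellH_mul_translate.
Qed.

Lemma fellH_inv_continuous : continuous (ginv h).
Proof.
move=> A.
apply: (@fell_cvg _ _ _ (fmap_filter (ginv h) (nbhs_filter A))) => [V oV [x]|x].
  rewrite hinvE => -[[y Ay <-] Vy].
  have := nbhs_hit (lcG.1.2 _ _ (open_nbhs_nbhs (conj oV Vy))) Ay.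
  apply: filterS => B [z [Bz Vz]]; exists z^-1; split=> //.
  by rewrite hinvE; exists z.
rewrite hinvE => nAx.
have nA : ~ pts A x^-1.
  by move=> Ax; apply: nAx; exists x^-1 => //; rewrite ginvK.
have [Q [xQ cQ AQ]] := fell_avoid lcG.2 nA.
exists (ginv g @^-1` Q); first exact: lcG.1.2.
apply: (@filterS _ (nbhs A)) (nbhs_miss cQ AQ) => B BQ.
apply/seteqP; split=> // z []; rewrite hinvE => -[y By <-] /=.
rewrite ginvK => Qy.
by have : set0 y by rewrite -BQ.
Qed.

(** A unit [u] in [A] gives [A A^-1 = A u^-1 = A]. *)
Lemma fellH_unitP A : unit_space h A <-> exists2 u, unit_space g u & pts A u.
Proof.
split=> [[B _ <-]|[u [x _ <-] Au]].
  by have [x Bx] := fell_pts_neq0 B; exists (r x);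
    [exists x|exact: fellH_rng_mem].
exists A => //; apply: fell_pts_inj; rewrite (fellH_rng_translate Au).
have e : (r x)^-1 = r x.
  by rewrite -[LHS](gmul_src g) gsrc_inv grng_rng ginv_mul gsrc_rng.
rewrite e; apply/seteqP; split=> z.
  by move=> /translateP[y [Ay yx ->]]; rewrite -grng_rng -yx gmul_src.
move=> Az; apply/translateP; exists z.
have [_ zx] := (coset A).1 _ _ Az Au; rewrite grng_rng zx gsrc_rng; split=> //.
by rewrite -[r x](gsrc_rng g) -zx gmul_src.
Qed.

(** The singletons of points [z] converge to [B] along an ultrafilter defining
    [B], so the range of [B] is the limit of the singletons [{r z}].
    Conversely, let [A] be in the closure of the singletons of units and let
    [x] be in [A].  If [A] missed a neighbourhood [Q] of [r x], the singleton of
    some unit [v] would miss [Q] with [v] so close to [x] that [r v] lies in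
    [Q]; but [v = r v]. *)
Lemma fellH_units_closure : unit_space h =
  closure [set A | exists2 u, unit_space g u & pts A = [set u]].
Proof.
apply/seteqP; split=> A.
  move=> [B _ <-] W /fellH_rng_continuous BW; have [F FU BF] := fell_ptsP B.
  have [p pE] := choice (fell_point lcG.2).
  have FW : F [set z | W (grng h (p z))] :=
    fell_point_cvg pE FU BF BW.
  have [z Wz] := filter_ex FW; exists (grng h (p z)); split=> //.
  exists (r z); first by exists z.
  rewrite (@fellH_rng_translate _ z) pE//; apply/seteqP; split=> w.
    by move=> /translateP[_ [-> _ ->]]; rewrite gmul_inv.
  by move=> ->; apply/translateP; exists z; rewrite grng_inv gmul_inv.
move=> clA; have [x Ax] := fell_pts_neq0 A.
apply/fellH_unitP; exists (r x); first by exists x.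
apply: contrapT => /(fell_avoid lcG.2)[Q [xQ cQ AQ]].
have AmQ := nbhs_miss cQ AQ.
have := clA _ (filterI AmQ (nbhs_hit (grng_continuous xQ) Ax)).
move=> [B [[_ [v _ <-] Bu] [BQ [w [Bw]]]]] /=.
move: Bw; rewrite Bu => -> /=; rewrite grng_rng => Qv.
by have : set0 (r v) by rewrite -BQ Bu.
Qed.

Lemma fellH_translate_rng B y : pts B y ->
  pts B = translate g (pts (grng h B)) y.
Proof.
move=> By; rewrite -{1}(gmul_rng h B) (@fellH_mul_translate _ B y)//.
exact: gsrc_rng.
Qed.

(** A unit [grng h B] of [fellH G] that contains some [z] over [r(V)], say with
    [r z = r v], is the range of its translate by [v]. *)
Lemma fellH_rng_hit V W : r @` V = unit_space g `&` W ->
  grng h @` hit V = unit_space h `&` hit (r @^-1` W).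
Proof.
move=> rV; apply/seteqP; split.
  move=> _ [B [y [By Vy]] <-].
  split; first by exists B.
  exists (r y); split; first exact: fellH_rng_mem.
  have : (r @` V) (r y) by exists y.
  by rewrite rV => -[_]; rewrite /= grng_rng.
move=> _ [[B _ <-] [z [Bz Wz]]]; have [b Bb] := fell_pts_neq0 B.
have zb := fellH_rng_mem_eq Bb Bz.
have [v Vv vz] : (r @` V) (r z) by rewrite rV; split=> //; exists z.
have Bv y : pts (grng h B) y -> s y = r v.
  move=> By; have [_ ->] := (coset _).1 _ _ By (fellH_rng_mem Bb).
  by rewrite gsrc_rng vz zb.
have [C CE] := translate_exists Bv.
have Cv : pts C v.
  rewrite CE; apply/translateP; exists (r b); rewrite gsrc_rng vz zb.
  by split=> //; [exact: fellH_rng_mem|rewrite -zb -vz gmul_rng].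
exists C; first by exists v.
apply: fell_pts_inj; rewrite (fellH_rng_translate Cv) CE.
exact: translateKV.
Qed.

Lemma fellH_rng_hit_inj V B C :
    (forall v w, V v -> V w -> r v = r w -> v = w) ->
  hit V B -> hit V C -> grng h B = grng h C -> B = C.
Proof.
move=> rinj [y [By Vy]] [z [Cz Vz]] e.
have yz : y = z.
  apply: rinj => //; rewrite -(grng_rng g).
  by apply: (@fellH_rng_mem_eq C) => //; rewrite -e; exact: fellH_rng_mem.
rewrite -yz in Cz; apply: fell_pts_inj.
by rewrite (fellH_translate_rng By) (fellH_translate_rng Cz) e.
Qed.

Lemma fellH_etale : etale h.
Proof.
move=> A; have [x Ax] := fell_pts_neq0 A.
have [V [oV [W oW rV] _ [t [tK tcont]]] Vx] := etaleG x.
have rinj v w : V v -> V w -> r v = r w -> v = w.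
  by move=> Vv Vw e; rewrite -(tK _ (mem_set Vv)) e (tK _ (mem_set Vw)).
exists (hit V); last by exists x.
split; first exact: open_hit.
- exists (hit (r @^-1` W)); last exact: fellH_rng_hit.
  by apply: open_hit; apply: open_comp => // y _; exact: grng_continuous.
- exact/continuous_subspaceT/fellH_rng_continuous.
(* [T] is the inverse of the range map on [hit V]; [A] is a default value *)
have T_ex (H : fellH G) : exists B,
    (grng h @` hit V) H -> hit V B /\ grng h B = H.
  have [[B BV BH]|nH] := pselect ((grng h @` hit V) H); first by exists B.
  by exists A => /nH.
have [T TE] := choice T_ex.
have TK B : hit V B -> T (grng h B) = B.
  move=> BV; have [|TV TB] := TE (grng h B); first by exists B.
  by apply: fellH_rng_hit_inj TB; first exact: rinj.
exists T; split; first by move=> B /set_mem; exact: TK.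
apply/subspace_continuousP => _ [B [y [By Vy]] <-].
have BV : hit V B by exists y.
apply: (@fell_cvg_translate _ _ id T (grng h B) (T (grng h B)) y).
- exact: cvg_within.
- by rewrite TK//; exact: fellH_translate_rng.
move=> U yU.
have rVy : (r @` V) (r y) by exists y.
(* for [H] near [grng h B], the section [t] of [V] sends the range of [H] near
   to [t (r y) = y], and this is the point in which [T H] meets [V] *)
have tU : nbhs (r y) [set u | (r @` V) u -> U (t u)].
  have ty : t @ within (r @` V) (nbhs (r y)) --> t (r y).
    by move/subspace_continuousP : tcont; exact.
  by rewrite (tK _ (mem_set Vy)) in ty; exact: ty.
have rtU : nbhs (r y) (r @^-1` [set u | (r @` V) u -> U (t u)]).
  by apply: grng_continuous => //; rewrite grng_rng.
rewrite near_withinE; have := nbhs_hit rtU (fellH_rng_mem By).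
apply: filterS => H [z [Hz Uz]] VH; have [[w [Tw Vw]] TH] := TE _ VH.
exists w; last by rewrite {1}(fellH_translate_rng Tw) TH.
have rzw : r z = r w by apply: fellH_rng_mem_eq Tw _; rewrite TH.
have : U (t (r w)) by rewrite -rzw; apply: Uz; rewrite rzw; exists w.
by rewrite (tK _ (mem_set Vw)).
Qed.

End EtaleGroupoid.

Theorem proposition2p6 (G : topologicalType) (g : groupoid G)
    (lcG : locally_compact_groupoid g)
    (hausdorffG0 : hausdorff_space (set_type (unit_space g)))
    (open_rs : open_range_source g)
    (etaleG : etale g) :
  exists h : groupoid (fellH G),
    [/\ is_fell_groupoid g h, locally_compact_groupoid h,
        hausdorff_space (fellH G) & etale h].
Proof.
have [h [hrng hsrc hmul hinv]] := fell_groupoid_exists lcG hausdorffG0 etaleG.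
exists h; split.
- by split=> //; exact: (fellH_units_closure lcG hausdorffG0 hrng).
- split; last exact: fellH_locally_compact lcG.2.
  split; first exact: (fellH_mul_continuous lcG hausdorffG0 hrng hsrc hmul).
  exact: (fellH_inv_continuous lcG hinv).
- exact: fellH_hausdorff lcG.2.
- exact: (fellH_etale lcG hausdorffG0 etaleG hrng hsrc hmul).
Qed.
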